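(* Let $k,r\ge 1$ be integers, $p\in(0,1)$, $q=1-p$. Let $Y$ be the waiting time for the $r$-th nonoverlapping success run of length $k$ (negative binomial distribution $\mathrm{NB}_{k,r}$ of Type I). Then: (i) for every integer $n\ge 1$, $$\mathbb{P}(Y-rk=n)=p^{rk}\sum_{j=0}^{\lfloor (n-1)/k\rfloor}(-1)^jp^{jk}q^j\binom{r+j-1}{r-1}\left[\sum_{i=0}^r\binom{r}{i}\binom{n-jk-1}{j+i-1}q^i\right];$$ (ii) for every integer $n\ge rk+1$, $$\mathbb{P}(Y=n)=p^{rk}\sum_{j=0}^{\lfloor (n-rk-1)/k\rfloor}(-1)^jp^{jk}q^j\binom{r+j-1}{r-1}\left[\sum_{i=0}^r\binom{r}{i}\binom{n-(r+j)k-1}{j+i-1}q^i\right].$$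
   Context: Consider independent Bernoulli trials, indexed $1,2,3,\dots$, each with success probability $p$. Success runs of length $k$ are counted in the nonoverlapping sense: as soon as $k$ consecutive successes are attained, a run is counted and the counting for a new run begins from scratch with the next trial. $Y$ is the index of the trial at which the $r$-th such run is completed; equivalently, $Y$ is the sum of $r$ independent copies of the waiting time for the first run of $k$ consecutive successes. The smallest possible value of $Y$ is $rk$, with $\mathbb{P}(Y=rk)=p^{rk}$. Convention: $\binom{a}{b}=0$ unless $0\le b\le a$; in particular $\binom{a}{-1}=0$. *)

(* Defs.v *)
From HB Require Import structures.
From mathcomp Require Import all_boot all_order all_algebra finmap.
From mathcomp Require Import all_classical all_reals all_analysis.

Set Implicit Arguments.
Unset Strict Implicit.
Unset Printing Implicit Defensive.

Import Order.TTheory GRing.Theory Num.Theory.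
Local Open Scope classical_set_scope.
Local Open Scope ring_scope.

(* Binomial coefficient with integer arguments, 0 unless 0 <= b <= a. *)
Definition binz (a b : int) : nat :=
  if 0 <= b <= a then 'C(`|a|%N, `|b|%N) else 0%N.

(* Mutual independence: the product rule on every finite subfamily. *)
Definition mutually_independent (d d' : measure_display)
    (T : measurableType d) (T' : measurableType d') (R : realType)
    (P : probability T R) (I : choiceType) (X : I -> {RV P >-> T'}) : Prop :=
  forall (J : {fset I}) (A : I -> set T'),
    (forall i, measurable (A i)) ->
    P (\bigcap_(i in [set` J]) (X i @^-1` A i)) =
    (\prod_(i <- J) P (X i @^-1` A i))%E.

(* Outcome sequences are 0-based: x i is the outcome of trial number i.+1.
   The state after n trials is the pair (number of runs of length k counted so
   far, length of the current streak of successes); the streak is reset to 0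
   when a run is counted, so runs do not overlap. *)
Fixpoint run_state (k : nat) (x : nat -> bool) (n : nat) : nat * nat :=
  if n is m.+1 then
    let: (c, s) := run_state k x m in
    if x m then (if s.+1 == k then (c.+1, 0%N) else (c, s.+1)) else (c, 0%N)
  else (0%N, 0%N).

Definition num_runs (k : nat) (x : nat -> bool) (n : nat) : nat :=
  (run_state k x n).1.

(* The least n such that exactly r runs are counted in the first n trials,
   i.e. the index of the trial that completes the r-th run;
   it is +oo when there are fewer than r runs in total. *)
Definition run_waiting_time (R : realType) (k r : nat) (x : nat -> bool) :
    \bar R :=
  ereal_inf [set n%:R%:E | n in [set n : nat | num_runs k x n = r]].

(* Main.v *)
Require Import Defs.
From HB Require Import structures.
From mathcomp Require Import all_boot all_order all_algebra finmap.
From mathcomp Require Import all_classical all_reals all_analysis.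
From mathcomp Require Import ring zify.

Set Implicit Arguments.
Unset Strict Implicit.
Unset Printing Implicit Defensive.

Import Order.TTheory GRing.Theory Num.Theory.
Local Open Scope classical_set_scope.
Local Open Scope ring_scope.

(** The argument is generating functions, with power series replaced by
elements of a commutative algebra generated by a nilpotent [x].

Write [q = 1 - p], and follow the pair (runs counted, current streak) along the
trials.  Its law after [n.+1] trials is a linear function of its law after [n]
trials, because trial [n] is independent of the first [n] trials
([chain_indep], [chain_total]).  The [r.+1]-st run is completed at trial
[n.+1] exactly when the state after [n] trials is [(r, k.-1)] and the next
trial succeeds ([run_waiting_timeS]).

Let [U_c] be the generating function of the probabilities that [c] runs have
been counted and the streak is empty, and put
  [d = 1 - x + q p^k x^(k+1)].
A streak of length [s] has generating function [(p x)^s U_c]; summing over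
[s < k] turns the recurrence for [U_c] into
  [d U_0 = 1 - p x]  and  [d U_(c+1) = (1 - p x) (p x)^k U_c],
so that the generating function [V] of the waiting time of run number [r]
satisfies [d^r V = (1 - p x)^r (p x)^(rk)] ([chain_gf]).

To read off the coefficients, put [g = 1/(1 - x)] and [b = q p^k x^(k+1) g].
Then [d g = 1 + b] and [(1 - p x) g = 1 + q x g], hence
  [V = (p x)^(rk) (1 + q x g)^r (1 + b)^(-r)].
The middle factor is expanded by the binomial theorem (index [i] of the
formula), the last one by the negative binomial series (index [j]), and the
powers [g^(i+j)] that appear by the negative binomial series again
([gf_run_coef]).  For a fixed coefficient all of this takes place in
[R[X]/(X^N)] with [N] large, where every series is a finite sum
([truncated_series_inj]). *)

(** * Generating functions truncated by a nilpotent element *)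

Section TruncatedSeries.
Variables (R : comNzRingType) (A : comAlgType R) (x : A) (N : nat).
Hypothesis xN0 : x ^+ N = 0.

(** The power series with coefficients [f], evaluated at the nilpotent [x]. *)
Definition gf (f : nat -> R) : A := \sum_(n < N) f n *: x ^+ n.

Lemma scale_in_alg a (y : A) : a *: y = GRing.in_alg A a * y.
Proof. by rewrite in_algE mulr_algl. Qed.

Lemma gf_recl f : gf f = (f 0%N)%:A + x * gf (fun n => f n.+1).
Proof.
have -> : gf f = \sum_(n < N.+1) f n *: x ^+ n.
  by rewrite big_ord_recr /= xN0 scaler0 addr0.
rewrite big_ord_recl expr0; congr (_ + _); rewrite mulr_sumr.
by apply: eq_bigr => i _; rewrite -scalerAr -exprS.
Qed.

Lemma eq_gf f g : f =1 g -> gf f = gf g.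
Proof. by move=> fg; apply: eq_bigr => i _; rewrite fg. Qed.

Lemma gf0 : gf (fun=> 0) = 0.
Proof. by apply: big1 => i _; rewrite scale0r. Qed.

Lemma gfZ a f : gf (fun n => a * f n) = a *: gf f.
Proof. by rewrite scaler_sumr; apply: eq_bigr => i _; rewrite scalerA. Qed.

Lemma gfD f g : gf (fun n => f n + g n) = gf f + gf g.
Proof. by rewrite -big_split; apply: eq_bigr => i _; rewrite scalerDl. Qed.

Lemma gf_sum m (F : 'I_m -> nat -> R) :
  gf (fun n => \sum_(i < m) F i n) = \sum_(i < m) gf (F i).
Proof.
by rewrite exchange_big; apply: eq_bigr => n _; rewrite scaler_suml.
Qed.

Lemma gf_shift a f :
  gf (fun n => if (a <= n)%N then f (n - a)%N else 0) = x ^+ a * gf f.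
Proof.
elim: a => [|a IHa]; first by rewrite mul1r; apply: eq_gf => n; rewrite subn0.
by rewrite gf_recl scale0r add0r exprS -mulrA -IHa.
Qed.

(** By induction on [m]: multiplying the series of exponent [m.+1] by [1 - t]
telescopes, by Pascal's rule, to the series of exponent [m] up to a multiple of
[t ^+ N].  The predecessor makes the series of exponent [0] equal to [1]. *)
Lemma negative_binomial m (t : A) : t ^+ N = 0 ->
  (1 - t) ^+ m * (\sum_(j < N) 'C((m + j).-1, j)%:R * t ^+ j) = 1.
Proof.
move=> tN0; elim: m => [|m IHm].
  rewrite mul1r; case: N tN0 => [|M] tN0.
    by rewrite big_ord0 -tN0 expr0.
  rewrite big_ord_recl bin0 expr0 mulr1 big1 ?addr0 // => i _.
  by rewrite add0n bin_small ?mul0r.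
have partial M : (1 - t) * (\sum_(j < M) 'C((m.+1 + j).-1, j)%:R * t ^+ j) =
    (\sum_(j < M) 'C((m + j).-1, j)%:R * t ^+ j)
    - (if M is M'.+1 then 'C(m + M', M')%:R else 0) * t ^+ M.
  elim: M => [|M IHM]; first by rewrite !big_ord0; ring.
  rewrite !big_ord_recr /= mulrDr IHM exprS.
  case: M {IHM} => [|M]; first by rewrite addn0 !bin0; ring.
  by rewrite addnS /= binS natrD !exprS; ring.
by rewrite exprSr -mulrA partial tN0 mulr0 subr0.
Qed.

Lemma geometricX_inv : (1 - x) * gf (fun=> 1) = 1.
Proof. by rewrite mulrBl mul1r {1}gf_recl scale1r addrK. Qed.

Lemma gf_geometricX m :
  (gf (fun=> 1)) ^+ m = gf (fun n => 'C((m + n).-1, n)%:R).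
Proof.
set g := gf _; set S := gf _.
have invS : (1 - x) ^+ m * S = 1.
  rewrite -[RHS](negative_binomial m xN0); congr (_ * _).
  by apply: eq_bigr => i _; rewrite -mulr_algl scaler_nat.
rewrite -[LHS]mulr1 -invS mulrA -exprMn [g * _]mulrC geometricX_inv.
by rewrite expr1n mul1r.
Qed.

(** The coefficient of [x ^+ n] in
[(p x)^(rk) (1 + q x g)^r (1 + b)^(-r)] with [g = 1/(1 - x)] and
[b = q p^k x^(k+1) g], before simplification: [j] is the power of [- b], [i]
the power of [q x g], and the last binomial coefficient comes from [g^(j+i)].
Terms with [j >= N] vanish since [b] is a multiple of [x]. *)
Definition run_coef (k r : nat) (p : R) (n : nat) : R :=
  p ^+ (r * k) * \sum_(j < N) ((-1) ^+ j * p ^+ (j * k) * (1 - p) ^+ j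
    * 'C((r + j).-1, j)%:R) * \sum_(i < r.+1) ('C(r, i)%:R * (1 - p) ^+ i) *
     (if (r * k + j * k.+1 + i <= n)%N then
       'C((j + i + (n - (r * k + j * k.+1 + i))).-1,
          n - (r * k + j * k.+1 + i))%:R else 0).

(** Both sides of the hypothesis are multiplied by [g^r (1 + b)^(-r)], where
[g] is the inverse of [1 - x] and [d g = 1 + b]. *)
Lemma gf_run_coef k r p (V : A) :
  (1 - x + ((1 - p) * p ^+ k) *: x ^+ k.+1) ^+ r * V =
    (1 - p *: x) ^+ r * (p *: x) ^+ (r * k) ->
  V = gf (run_coef k r p).
Proof.
set q := 1 - p; set d := (1 - x + _) => dV.
pose g := gf (fun=> 1); pose b := (q * p ^+ k) *: x ^+ k.+1 * g.
have xg : (1 - x) * g = 1 by exact: geometricX_inv.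
have dg : d * g = 1 - - b by rewrite mulrDl xg opprK.
have pg : (1 - p *: x) * g = 1 + q *: x * g.
  by rewrite -[1 in RHS]xg -mulrDl scalerBl scale1r; congr (_ * _); ring.
have bN : (- b) ^+ N = 0.
  by rewrite /b exprS scalerAr -mulrA -mulrN exprMn xN0 mul0r.
have {dV} -> : V = (p *: x) ^+ (r * k)
    * (\sum_(j < N) 'C((r + j).-1, j)%:R * (- b) ^+ j)
    * (\sum_(i < r.+1) (q *: x * g) ^+ i *+ 'C(r, i)).
  have := negative_binomial r bN; set S := \sum_(j < N) _ => invS.
  have -> : \sum_(i < r.+1) (q *: x * g) ^+ i *+ 'C(r, i) =
      (1 - p *: x) ^+ r * g ^+ r.
    rewrite -exprMn pg exprDn; apply: eq_bigr => i _.
    by rewrite expr1n mul1r.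
  transitivity (d ^+ r * V * (g ^+ r * S)).
    by rewrite mulrAC mulrA -exprMn dg invS mul1r.
  by rewrite dV; ring.
(* From here on only the powers of [g] matter. *)
have gE m : gf (fun n => 'C((m + n).-1, n)%:R) = g ^+ m.
  by rewrite gf_geometricX.
clearbody g.
rewrite /run_coef gfZ gf_sum exprZn -mulrA -scalerAl; congr (_ *: _).
rewrite mulr_suml mulr_sumr; apply: eq_bigr => j _.
rewrite gfZ gf_sum !mulr_sumr scaler_sumr; apply: eq_bigr => i _.
rewrite gfZ (gf_shift _ (fun l => 'C((j + i + l).-1, l)%:R)) gE -/q /b.
rewrite -mulNr -mulr_natr !scale_in_alg.
rewrite -mulN1r !(rmorphM, rmorphXn, rmorphN, rmorph1, rmorph_nat) /=.
rewrite !(exprMn, exprD) -!exprM [(k * j)%N]mulnC [(k.+1 * j)%N]mulnC.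
rewrite -(mulr_natr _ 'C(r, i)); ring.
Qed.

(** * From the recurrences of the chain to the waiting time *)

(** Here [u c s n] stands for the probability of having counted [c] runs with a
current streak [s] after [n] trials, and [y n] for the probability that run
number [r.+1] is completed at trial [n].  The denominator comes from
[1 - p x - q x (1 - (p x)^k) = 1 - x + q p^k x^(k+1)], where
[(1 - (p x)^k) / (1 - p x)] is the sum of the possible streaks. *)
Lemma chain_gf k p (u : nat -> nat -> nat -> R) :
  (0 < k)%N ->
  (forall c s, u c s 0%N = ((c == 0%N) && (s == 0%N))%:R) ->
  (forall c s n, (s.+1 < k)%N -> u c s.+1 n.+1 = p * u c s n) ->
  (forall c n, u c 0%N n.+1 = (1 - p) * (\sum_(s < k) u c s n)
     + (if c is c'.+1 then p * u c' k.-1 n else 0)) ->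
  forall r (y : nat -> R), y 0%N = 0 ->
  (forall n, y n.+1 = p * u r k.-1 n) ->
  (1 - x + ((1 - p) * p ^+ k) *: x ^+ k.+1) ^+ r.+1 * gf y =
    (1 - p *: x) ^+ r.+1 * (p *: x) ^+ (r.+1 * k).
Proof.
move=> k0 ustart ustreak uzero r y y0 yS.
set d := (1 - x + _); set t := p *: x.
have streak c s : (s < k)%N -> gf (u c s) = t ^+ s * gf (u c 0%N).
  elim: s => [|s IHs] sk; first by rewrite mul1r.
  rewrite gf_recl ustart andbF scale0r add0r.
  rewrite (eq_gf (fun n => ustreak c s n sk)).
  by rewrite gfZ (IHs (ltnW sk)) /t exprS; rewrite -scalerAr -!scalerAl mulrA.
have last_streak c : p *: (x * gf (u c k.-1)) = t ^+ k * gf (u c 0%N).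
  rewrite streak ?prednK // -{2}(prednK k0) exprS /t.
  by rewrite -!scalerAl mulrA.
have zero c : gf (u c 0%N) = (c == 0%N)%:R
    + ((1 - p) *: x) * ((\sum_(s < k) t ^+ s) * gf (u c 0%N))
    + (if c is c'.+1 then t ^+ k * gf (u c' 0%N) else 0).
  rewrite {1}gf_recl ustart andbT scaler_nat (eq_gf (uzero c)) gfD gfZ gf_sum.
  rewrite mulr_suml (eq_bigr _ (fun (s : 'I_k) _ => streak c s (ltn_ord s))).
  rewrite mulrDr addrA -scalerAl -scalerAr; congr (_ + _ + _).
  by case: c => [|c]; rewrite ?gf0 ?mulr0 // gfZ -scalerAr last_streak.
have dzero c : d * gf (u c 0%N) = (1 - t) * ((c == 0%N)%:R
    + (if c is c'.+1 then t ^+ k * gf (u c' 0%N) else 0)).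
  have tk : (1 - t) * (\sum_(s < k) t ^+ s) = 1 - t ^+ k.
    by rewrite -[RHS]opprB subrX1 -mulNr opprB.
  have dE : d = (1 - t) - ((1 - p) *: x) * (1 - t ^+ k).
    rewrite /d /t exprZn exprS !scale_in_alg.
    rewrite !(rmorphM, rmorphB, rmorph1, rmorphXn).
    ring.
  have := zero c; set U := gf _; set S := \sum_(s < k) _ in zero tk *.
  set W := (if _ is _.+1 then _ else _) => UE.
  have -> : (c == 0%N)%:R + W = U - (1 - p) *: x * (S * U).
    by rewrite {1}UE; ring.
  by rewrite dE -tk; ring.
have -> : gf y = t ^+ k * gf (u r 0%N).
  by rewrite gf_recl y0 scale0r add0r (eq_gf yS) gfZ -scalerAr last_streak.
elim: r {y y0 yS} => [|r IHr].
  by rewrite !expr1 mulrCA dzero mul1n addr0 mulr1 mulrC.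
rewrite exprS mulSn (exprD t).
transitivity (d ^+ r.+1 * t ^+ k * (d * gf (u r.+1 0%N))); first by ring.
rewrite dzero add0r.
transitivity ((1 - t) * t ^+ k * (d ^+ r.+1 * (t ^+ k * gf (u r 0%N)))).
  by ring.
by rewrite IHr [(1 - t) ^+ r.+2]exprS; ring.
Qed.
End TruncatedSeries.

(** In the quotient of the polynomials by ['X^(n.+1)] the powers of the class of
['X] up to the [n]-th are linearly independent, so an identity of truncated
series that holds in every algebra can be read coefficientwise. *)
Lemma truncated_series_inj (R : comNzRingType) (f g : nat -> R) n :
  (forall (A : comAlgType R) (x : A), x ^+ n.+1 = 0 ->
    gf x n.+1 f = gf x n.+1 g) ->
  f n = g n.
Proof.
move=> fg; pose h : {poly R} := 'X^(n.+1).
pose x : {poly %/ h} := in_qpoly h 'X.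
have szh : size (mk_monic h) = n.+2 by rewrite mk_monic_Xn size_polyXn.
have xn0 : x ^+ n.+1 = 0.
  rewrite -rmorphXn; apply: val_inj => /=.
  by rewrite mk_monic_Xn /= Pdiv.RingMonic.rmodpp ?monicXn.
have coef_gf e : (gf x n.+1 e : {poly %/ h})`_n = e n.
  have -> : gf x n.+1 e = in_qpoly h (\poly_(i < n.+1) e i).
    rewrite poly_def raddf_sum; apply: eq_bigr => i _.
    by rewrite [RHS]in_qpolyZ rmorphXn.
  by rewrite in_qpoly_small ?szh ?ltnS ?size_poly // coef_poly ltnSn.
by rewrite -coef_gf (fg _ x xn0) coef_gf.
Qed.


(** * The run chain along one sequence of trials *)

Definition run_step (k : nat) (st : nat * nat) (b : bool) : nat * nat :=
  if b then (if st.2.+1 == k then (st.1.+1, 0%N) else (st.1, st.2.+1))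
  else (st.1, 0%N).

Lemma run_stateS k x n :
  run_state k x n.+1 = run_step k (run_state k x n) (x n).
Proof. by rewrite /run_step /=; case: (run_state k x n). Qed.

Section WaitingTime.
Variables (k : nat) (x : nat -> bool).
Hypothesis k0 : (0 < k)%N.

Lemma streak_lt n : ((run_state k x n).2 < k)%N.
Proof.
elim: n => [//|n IHn]; rewrite run_stateS /run_step.
case: (x n) => //=; case: eqP => //= /eqP neq.
by rewrite ltn_neqAle neq.
Qed.

Lemma num_runsS n : num_runs k x n.+1 =
  (num_runs k x n + (x n && ((run_state k x n).2 == k.-1)))%N.
Proof.
rewrite /num_runs run_stateS /run_step.
have -> s : (s == k.-1) = (s.+1 == k) by rewrite -eqSS prednK.
by case: (x n); case: eqP => //=; rewrite ?addn1 ?addn0.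
Qed.

Lemma leq_num_runs m n : (m <= n)%N -> (num_runs k x m <= num_runs k x n)%N.
Proof.
move=> /subnK <-; elim: (n - m)%N => // l IHl.
by rewrite (leq_trans IHl) // addSn num_runsS leq_addr.
Qed.

(** The infimum defining the waiting time is attained as soon as its index set
is nonempty, and is [+oo] otherwise. *)
Lemma run_waiting_timeE (R : realType) r n :
  (run_waiting_time R k r x = n%:R%:E) <->
  (num_runs k x n = r /\ forall m, (m < n)%N -> num_runs k x m <> r).
Proof.
rewrite /run_waiting_time; set S := [set _ | _ in _]; split; last first.
  move=> [nr first_n]; apply/eqP; rewrite eq_le; apply/andP; split.
    by apply: ereal_inf_lbound; exists n.
  apply: le_ereal_inf_tmp => _ [m /= mr <-]; rewrite lee_fin ler_nat leqNgt.
  by apply/negP => /first_n; rewrite mr.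
case: (pselect (exists m, num_runs k x m == r)) => [|none]; last first.
  suff -> : S = set0 by rewrite ereal_inf0.
  by apply/seteqP; split => // _ [m /= /eqP mr _]; apply: none; exists m.
move=> ex; case: (ex_minnP ex) => m /eqP mr min_m.
have -> : ereal_inf S = m%:R%:E.
  apply/eqP; rewrite eq_le; apply/andP; split.
    by apply: ereal_inf_lbound; exists m.
  apply: le_ereal_inf_tmp => _ [l /= /eqP lr <-]; rewrite lee_fin ler_nat.
  exact: min_m.
move=> [] /eqP; rewrite eqr_nat => /eqP <-; split=> // l lm /eqP lr.
by have := min_m _ lr; rewrite leqNgt lm.
Qed.

Lemma run_waiting_time_gt0 (R : realType) r :
  run_waiting_time R k r.+1 x <> 0%:R%:E.
Proof. by move/run_waiting_timeE => []. Qed.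

(** The number of runs is nondecreasing with steps at most [1], so its first
visit to [r.+1] is the step up from [r]. *)
Lemma run_waiting_timeS (R : realType) r n :
  (run_waiting_time R k r.+1 x = n.+1%:R%:E) <->
  (run_state k x n = (r, k.-1) /\ x n = true).
Proof.
rewrite run_waiting_timeE num_runsS; split.
  move=> [+ /(_ n (ltnSn n))]; rewrite /num_runs.
  case: (x n); case: (run_state k x n) => c s /=; last by rewrite addn0.
  by case: eqP => [->|_]; rewrite ?addn0 // addn1 => -[->].
rewrite /num_runs => -[st ->]; rewrite st eqxx addn1; split=> // m.
rewrite ltnS => /leq_num_runs; rewrite /num_runs st /= => le eq.
by rewrite eq ltnn in le.
Qed.
End WaitingTime.

(** * Chains driven by independent trials *)

Section DrivenChain.
Variables (d : measure_display) (T : measurableType d) (R : realType).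
Variables (P : probability T R) (X : nat -> {RV P >-> bool}).
Hypothesis X_indep : mutually_independent X.
Variables (S : Type) (s0 : S) (step : S -> bool -> S).

Definition chain (w : T) (n : nat) : S :=
  (fix chain n := if n is m.+1 then step (chain m) (X m w) else s0) n.

Lemma measurable_trial i (U : set bool) : measurable (X i @^-1` U).
Proof. exact: measurable_funPTI. Qed.
Hint Resolve measurable_trial : core.

Lemma chain_split n (B : set S) : [set w | B (chain w n.+1)] =
  ([set w | B (step (chain w n) true)] `&` X n @^-1` [set true]) `|`
  ([set w | B (step (chain w n) false)] `&` X n @^-1` [set false]).
Proof.
apply/seteqP; split=> w /=; case: (X n w) => //=.
- by left.
- by right.
- by case=> -[].
- by case=> -[].
Qed.

Lemma measurable_chain n (B : set S) : measurable [set w | B (chain w n)].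
Proof.
elim: n B => [|n IHn] B /=.
  have [?|?] := pselect (B s0).
    by rewrite (_ : mkset _ = setT) //; apply/seteqP; split.
  by rewrite (_ : mkset _ = set0) //; apply/seteqP; split.
rewrite (chain_split n B).
apply: measurableU; apply: measurableI (measurable_trial _ _).
- exact: (IHn (fun s => B (step s true))).
- exact: (IHn (fun s => B (step s false))).
Qed.

Lemma chain_splitP n (B : set S) (C : set T) : measurable C ->
  P ([set w | B (chain w n.+1)] `&` C) =
  (P ([set w | B (step (chain w n) true)] `&` (X n @^-1` [set true] `&` C)) +
   P ([set w | B (step (chain w n) false)] `&` (X n @^-1` [set false] `&` C)))%E.
Proof.
move=> mC; rewrite chain_split setIUl measureU; last 1 first.
- by apply/seteqP; split=> // w /= [[[_ ->] _] [[_ +] _]].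
- by rewrite !setIA.
- apply: measurableI mC; apply: measurableI (measurable_trial _ _).
  exact: (measurable_chain n (fun s => B (step s true))).
- apply: measurableI mC; apply: measurableI (measurable_trial _ _).
  exact: (measurable_chain n (fun s => B (step s false))).
Qed.

(** The state after [n] trials is independent of any finite family of events
about later trials.  Allowing a whole family [J] makes the induction go through:
splitting on the outcome of trial [n] moves that trial into the family. *)
Lemma chain_indep n (B : set S) (J : {fset nat}) (A : nat -> set bool) :
  (forall i, i \in J -> (n <= i)%N) ->
  P ([set w | B (chain w n)] `&` \bigcap_(i in [set` J]) (X i @^-1` A i)) =
  (P [set w | B (chain w n)] * \prod_(i <- J) P (X i @^-1` A i))%E.
Proof.
have mcap (I : {fset nat}) (U : nat -> set bool) :
    measurable (\bigcap_(i in [set` I]) (X i @^-1` U i)).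
  by apply: fin_bigcap_measurable => // i _.
elim: n B J A => [|n IHn] B J A Jn /=.
  have [?|?] := pselect (B s0).
    rewrite (_ : mkset _ = setT); last by apply/seteqP; split.
    by rewrite setTI probability_setT mul1e X_indep.
  rewrite (_ : mkset _ = set0); last by apply/seteqP; split.
  by rewrite set0I measure0 mul0e.
have nJ : n \notin J by apply/negP => /Jn; rewrite ltnn.
have trials_indep b (D : set S) :
    P ([set w | D (chain w n)] `&` (X n @^-1` [set b] `&`
        \bigcap_(i in [set` J]) (X i @^-1` A i))) =
    (P [set w | D (chain w n)] * P (X n @^-1` [set b])
      * \prod_(i <- J) P (X i @^-1` A i))%E.
  pose A' i := if i == n then [set b] else A i.
  have A'J i : i \in J -> A' i = A i.
    by rewrite /A'; case: eqP => // -> nJ'; rewrite nJ' in nJ.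
  have := IHn D (n |` J)%fset A'.
  rewrite big_fsetU1 //= {2}/A' eqxx.
  rewrite (eq_big_seq _
    (fun i iJ => congr1 (fun U => P (X i @^-1` U)) (A'J i iJ))).
  rewrite muleA => <-; last first.
    by move=> i; rewrite !inE => /orP[/eqP ->//|/Jn/ltnW].
  congr (P (_ `&` _)); apply/seteqP; split=> w /=.
    move=> [wn wJ] i /=; rewrite !inE => /orP[/eqP->|iJ].
      by rewrite /A' eqxx.
    by rewrite (A'J _ iJ); exact: wJ.
  move=> wJ; split; first by have := wJ n; rewrite /A' /= eqxx !inE eqxx; exact.
  by move=> i /= iJ; rewrite -(A'J _ iJ); apply: wJ; rewrite /= !inE iJ orbT.
have trial_indep b (D : set S) :
    P ([set w | D (chain w n)] `&` X n @^-1` [set b]) =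
    (P [set w | D (chain w n)] * P (X n @^-1` [set b]))%E.
  have := IHn D [fset n]%fset (fun=> [set b]).
  rewrite big_seq_fset1 set_fset1 bigcap_set1; apply.
  by move=> i; rewrite inE => /eqP->.
rewrite chain_splitP // (trials_indep true (fun s => B (step s true)))
  (trials_indep false (fun s => B (step s false))).
rewrite -ge0_muleDl; [|by rewrite mule_ge0..].
rewrite -(trial_indep true (fun s => B (step s true)))
  -(trial_indep false (fun s => B (step s false))).
congr (_ * _)%E.
by rewrite -[in RHS](setIT [set w | B _]) chain_splitP // !setIT.
Qed.

Lemma chain_trial_indep n (B : set S) (b : bool) :
  P ([set w | B (chain w n)] `&` X n @^-1` [set b]) =
  (P [set w | B (chain w n)] * P (X n @^-1` [set b]))%E.
Proof.
have := @chain_indep n B [fset n]%fset (fun=> [set b]).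
rewrite big_seq_fset1 set_fset1 bigcap_set1; apply.
by move=> i; rewrite inE => /eqP->.
Qed.

Lemma chain_total n (B : set S) : P [set w | B (chain w n.+1)] =
  (P [set w | B (step (chain w n) true)] * P (X n @^-1` [set true]) +
   P [set w | B (step (chain w n) false)] * P (X n @^-1` [set false]))%E.
Proof.
rewrite -(setIT [set w | B _]) chain_splitP // !setIT.
by rewrite (chain_trial_indep n (fun s => B (step s true)))
  (chain_trial_indep n (fun s => B (step s false))).
Qed.

End DrivenChain.


(** * The law of the waiting time *)

Section SuccessRuns.
Variables (d : measure_display) (T : measurableType d) (R : realType).
Variables (P : probability T R) (X : nat -> {RV P >-> bool}).
Variables (k : nat) (p : R).
Hypothesis X_indep : mutually_independent X.
Hypothesis k0 : (0 < k)%N.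
Hypothesis p01 : 0 < p < 1.
Hypothesis X_bernoulli : forall i, distribution P (X i) =1 bernoulli_prob p.

Let state (w : T) (n : nat) := run_state k (fun i => X i w) n.

Lemma run_state_chain w n : state w n = chain X (0%N, 0%N) (run_step k) w n.
Proof. by elim: n => // n IHn; rewrite /state run_stateS -/(state w n) IHn. Qed.

Let state_set n (B : set (nat * nat)) : [set w | B (state w n)] =
  [set w | B (chain X (0%N, 0%N) (run_step k) w n)].
Proof. by apply/funext => w /=; rewrite run_state_chain. Qed.

Lemma measurable_run_state n (B : set (nat * nat)) :
  measurable [set w | B (state w n)].
Proof. by rewrite state_set; exact: measurable_chain. Qed.

Lemma prob_trial n b : P (X n @^-1` [set b]) = (if b then p else 1 - p)%:E.
Proof.
have := X_bernoulli n [set b]; rewrite /distribution /pushforward => ->.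
rewrite bernoulli_probE; last by case/andP: p01 => /ltW -> /ltW ->.
by case: b;
  rewrite !diracE !classical_sets.in_set1 /= ?mule1 ?mule0 ?adde0 ?add0e.
Qed.

Definition prob_state c s n : R := fine (P [set w | state w n = (c, s)]).

Lemma prob_stateE c s n :
  P [set w | state w n = (c, s)] = (prob_state c s n)%:E.
Proof.
rewrite fineK // fin_num_measure //.
exact: (measurable_run_state n [set (c, s)]).
Qed.

Lemma prob_state_start c s :
  prob_state c s 0 = ((c == 0%N) && (s == 0%N))%:R.
Proof.
rewrite /prob_state /state /=.
case: (boolP (_ && _)) => [/andP[/eqP-> /eqP->]|ne].
  by rewrite (_ : mkset _ = setT) ?probability_setT //; apply/seteqP; split.
rewrite (_ : mkset _ = set0) ?measure0 //; apply/seteqP; split=> // w [cs ss].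
by move: ne; rewrite -cs -ss.
Qed.

Lemma prob_stateS c s n : (prob_state c s n.+1)%:E =
  (P [set w | run_step k (state w n) true = (c, s)] * p%:E
   + P [set w | run_step k (state w n) false = (c, s)] * (1 - p)%:E)%E.
Proof.
rewrite -prob_stateE (state_set n.+1 [set (c, s)]) chain_total //.
rewrite !prob_trial -(state_set n [set st | run_step k st true = (c, s)]).
by rewrite -(state_set n [set st | run_step k st false = (c, s)]).
Qed.

Lemma prob_state_streak c s n : (s.+1 < k)%N ->
  prob_state c s.+1 n.+1 = p * prob_state c s n.
Proof.
move=> sk; apply: EFin_inj; rewrite prob_stateS EFinM -prob_stateE muleC.
rewrite (_ : [set w | run_step k _ false = _] = set0); last first.
  by apply/seteqP; split.
rewrite measure0 mul0e adde0; congr (_ * P _)%E; apply/seteqP; split=> w.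
  rewrite /= /run_step; case: (state w n) => c' s' /=.
  by case: eqP => // _ -[-> ->].
by move=> /= ->; rewrite /run_step /= ltn_eqF.
Qed.

Lemma prob_num_runs c n :
  P [set w | (state w n).1 = c] = (\sum_(s < k) prob_state c s n)%:E.
Proof.
rewrite -sumEFin (_ : mkset _ =
    \big[setU/set0]_(s < k) [set w | state w n = (c, s : nat)]).
  rewrite (@measure_bigsetU _ _ _ P (fun s => [set w | state w n = (c, s)])).
  - by apply: eq_bigr => s _; exact: prob_stateE.
  - by move=> s; exact: (measurable_run_state n [set (c, s)]).
  - by move=> s s' _ _ [w /= [-> []]].
rewrite -(bigcup_mkord k (fun s => [set w | state w n = (c, s)])).
apply/seteqP; split=> w /=; last by move=> [s _ /= ->].
move=> <-; exists (state w n).2; first exact: streak_lt.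
by rewrite /=; case: (state w n).
Qed.

Lemma prob_state_reset c n : prob_state c 0 n.+1 =
  (1 - p) * (\sum_(s < k) prob_state c s n)
  + (if c is c'.+1 then p * prob_state c' k.-1 n else 0).
Proof.
apply: EFin_inj; rewrite prob_stateS addeC [in RHS]EFinD [in RHS]EFinM muleC.
congr (_ * _ + _)%E.
  rewrite -prob_num_runs; congr (P _); apply/seteqP.
  by split=> w /=; rewrite /run_step /=; [case | move=> ->].
have eqk s : (s.+1 == k) = (s == k.-1) by rewrite -[in LHS](prednK k0).
case: c => [|c].
  rewrite (_ : mkset _ = set0) ?measure0 ?mul0e //; apply/seteqP; split=> // w.
  by rewrite /= /run_step; case: ifP.
rewrite EFinM -prob_stateE muleC; congr (_ * P _)%E; apply/seteqP; split=> w /=.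
  rewrite /run_step eqk; case: (state w n) => c' s' /=.
  by case: eqP => [->|_] [] // ->.
by move=> ->; rewrite /run_step eqk /= eqxx.
Qed.

Lemma prob_waiting_time0 r :
  P [set w | run_waiting_time R k r.+1 (fun i => X i w) = 0%:R%:E] = 0%E.
Proof.
rewrite (_ : mkset _ = set0) ?measure0 //.
by apply/seteqP; split=> // w /run_waiting_time_gt0.
Qed.

Lemma prob_waiting_timeS r n :
  P [set w | run_waiting_time R k r.+1 (fun i => X i w) = n.+1%:R%:E] =
  (p * prob_state r k.-1 n)%:E.
Proof.
rewrite (_ : mkset _ =
    [set w | [set (r, k.-1)] (state w n)] `&` X n @^-1` [set true]).
  rewrite state_set chain_trial_indep // -state_set prob_trial.
  by rewrite prob_stateE muleC.
by apply/seteqP; split=> w /=; rewrite run_waiting_timeS.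
Qed.

Lemma prob_waiting_time r n :
  P [set w | run_waiting_time R k r.+1 (fun i => X i w) = n%:R%:E] =
  (run_coef n.+1 k r.+1 p n)%:E.
Proof.
pose y n :=
  fine (P [set w | run_waiting_time R k r.+1 (fun i => X i w) = n%:R%:E]).
have y0 : y 0%N = 0 by rewrite /y prob_waiting_time0.
have yS m : y m.+1 = p * prob_state r k.-1 m by rewrite /y prob_waiting_timeS.
have <- : y n = run_coef n.+1 k r.+1 p n.
  apply: truncated_series_inj => A x xn0; apply: gf_run_coef => //.
  apply: (chain_gf xn0 k0 prob_state_start) => //.
  - by move=> c s m; exact: prob_state_streak.
  - exact: prob_state_reset.
by case: n => [|n]; rewrite ?y0 ?yS ?prob_waiting_time0 ?prob_waiting_timeS.
Qed.

End SuccessRuns.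

(** * Closed form of the coefficients *)

Lemma binz_nat (a b : nat) : binz a b = 'C(a, b).
Proof.
by rewrite /binz /= lez_nat; case: leqP => // ab; rewrite bin_small.
Qed.

(** Symmetry of the binomial coefficients.  The bounds match the convention for
[binz]: for [j = i = 0] the left side is ['C(m.-1, m)], which is [0] like the
binomial coefficient with lower index [-1]. *)
Lemma binz_complement (k m i j : nat) : (0 < m)%N ->
  (if (j * k.+1 + i <= m)%N then
     'C((j + i + (m - (j * k.+1 + i))).-1, m - (j * k.+1 + i)) else 0%N) =
  binz (m%:Z - j%:Z * k%:Z - 1) (j%:Z + i%:Z - 1).
Proof.
move=> m0; case: leqP => [le|gt]; last first.
  rewrite /binz ifF //; apply/negP; nia.
have [|ji0] := posnP (j + i).
  case: j i le => // -[] // _ _; rewrite mul0n addn0 subn0 bin_small ?prednK //.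
have -> : m%:Z - j%:Z * k%:Z - 1 = (m - j * k).-1%N :> int by nia.
have -> : j%:Z + i%:Z - 1 = (j + i).-1%N :> int by lia.
rewrite binz_nat -bin_sub; last by nia.
congr 'C(_, _); nia.
Qed.

(** The terms with [j] above [(m - 1) %/ k] vanish because the upper index
[m - j k - 1] is then negative. *)
Lemma run_coef_shift (R : realType) k r (p : R) N m :
  (0 < k)%N -> (0 < m)%N -> (m <= N)%N ->
  run_coef N k r.+1 p (r.+1 * k + m) =
  p ^+ (r.+1 * k) *
    \sum_(0 <= j < ((m - 1) %/ k).+1)
      (-1) ^+ j * p ^+ (j * k) * (1 - p) ^+ j
      * (binz (r.+1%:Z + j%:Z - 1) (r.+1%:Z - 1))%:R
      * (\sum_(0 <= i < r.+2)
           (binz r.+1%:Z i%:Z)%:R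
           * (binz (m%:Z - j%:Z * k%:Z - 1) (j%:Z + i%:Z - 1))%:R
           * (1 - p) ^+ i).
Proof.
move=> k0 m0 mN; rewrite /run_coef; congr (_ * _).
pose F j := (-1) ^+ j * p ^+ (j * k) * (1 - p) ^+ j
      * (binz (r.+1%:Z + j%:Z - 1) (r.+1%:Z - 1))%:R
      * (\sum_(0 <= i < r.+2)
           (binz r.+1%:Z i%:Z)%:R
           * (binz (m%:Z - j%:Z * k%:Z - 1) (j%:Z + i%:Z - 1))%:R
           * (1 - p) ^+ i) : R.
have lastN : (((m - 1) %/ k).+1 <= N)%N.
  by rewrite (leq_trans _ mN) // -(subnK m0) addn1 ltnS subn1 leq_div.
rewrite (eq_bigr (fun j : 'I_N => F j)) => [|j _].
  rewrite -(big_mkord xpredT F) (big_cat_nat _ lastN) //= [X in _ + X]big_nat.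
  rewrite [X in _ + X]big1 ?addr0 // => j /andP[+ _].
  rewrite ltn_divLR // => jk.
  rewrite /F [\sum_(_ <= _ < _) _]big1 ?mulr0 // => i _.
  rewrite [X in _ * X%:R](_ : _ = 0%N) ?mulr0 ?mul0r //.
  by rewrite /binz ifF //; apply/negP; nia.
rewrite /F big_mkord; congr (_ * _ * _).
  have -> : r.+1%:Z + j%:Z - 1 = (r + j)%N :> int by lia.
  have -> : r.+1%:Z - 1 = r :> int by lia.
  by rewrite binz_nat addSn /= -bin_sub ?leq_addl // addnK.
apply: eq_bigr => i _; rewrite binz_nat -binz_complement // mulrAC.
rewrite -addnA leq_add2l subnDl; congr (_ * _ * _).
by case: ifP.
Qed.

Theorem mainTheorem1 (d : measure_display) (T : measurableType d)
    (R : realType) (P : probability T R) (k r : nat) (p : R)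
    (X : nat -> {RV P >-> bool})
    (k_ge1 : (1 <= k)%N) (r_ge1 : (1 <= r)%N) (p01 : 0 < p < 1)
    (X_bernoulli : forall i : nat, distribution P (X i) =1 bernoulli_prob p)
    (X_indep : mutually_independent X) :
  let q := 1 - p in
  let Y := fun w : T => run_waiting_time R k r (fun i : nat => X i w) in
  (forall n : nat, (1 <= n)%N ->
     P [set w | (Y w - (r * k)%:R%:E)%E = n%:R%:E] =
     (p ^+ (r * k) *
        \sum_(0 <= j < ((n - 1) %/ k).+1)
           (-1) ^+ j * p ^+ (j * k) * q ^+ j
           * (binz (r%:Z + j%:Z - 1) (r%:Z - 1))%:R
           * (\sum_(0 <= i < r.+1)
                (binz r%:Z i%:Z)%:R
                * (binz (n%:Z - j%:Z * k%:Z - 1) (j%:Z + i%:Z - 1))%:R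
                * q ^+ i))%:E)
  /\
  (forall n : nat, (r * k + 1 <= n)%N ->
     P [set w | Y w = n%:R%:E] =
     (p ^+ (r * k) *
        \sum_(0 <= j < ((n - r * k - 1) %/ k).+1)
           (-1) ^+ j * p ^+ (j * k) * q ^+ j
           * (binz (r%:Z + j%:Z - 1) (r%:Z - 1))%:R
           * (\sum_(0 <= i < r.+1)
                (binz r%:Z i%:Z)%:R
                * (binz (n%:Z - (r%:Z + j%:Z) * k%:Z - 1)
                        (j%:Z + i%:Z - 1))%:R
                * q ^+ i))%:E).
Proof.
move=> q; case: r r_ge1 => // r' _ Y.
have key m n : (1 <= m)%N -> n = (m + r'.+1 * k)%N ->
    P [set w | Y w = n%:R%:E] = (run_coef n.+1 k r'.+1 p (r'.+1 * k + m))%:E.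
  move=> _ ->; rewrite /Y.
  by rewrite (prob_waiting_time X_indep k_ge1 p01 X_bernoulli) addnC.
split=> [n n1|n rkn].
  (* The infinite value of [Y] is not affected by the shift. *)
  have -> : [set w | (Y w - (r'.+1 * k)%:R%:E)%E = n%:R%:E] =
      [set w | Y w = (n + r'.+1 * k)%:R%:E].
    apply/funext => w /=; case: (Y w) => [y| |]; apply/propext; split=> //.
      by move=> [] /eqP; rewrite subr_eq natrD => /eqP ->.
    by move=> [->]; rewrite -EFinB natrD addrK.
  rewrite (key n) // run_coef_shift //; lia.
pose m := (n - r'.+1 * k)%N.
rewrite (key m); [|lia..].
rewrite run_coef_shift; [|lia..].
congr (_ * _)%:E; apply: eq_bigr => j _; congr (_ * _).
apply: eq_bigr => i _; congr (_ * (binz _ _)%:R * _).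
rewrite /m; nia.
Qed.
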